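(* The density $\mathcal D$ of $\mu$ satisfies $\mathcal D(t)\sim\dfrac{1}{\sqrt{2\pi(1-t)}}$ as $t\to1^-$.
   Context: Let $(m_n)$ be the positive sequence with $m_0=1$, $(1+m_1+\cdots+m_n)m_n=1$ ($n\ge1$), and $\mu$ the probability measure on $[0,1]$ with moments $m_n$. The measure $\mu$ is absolutely continuous on $]0,1[$ with an increasing density $\mathcal D$ (explicitly $\mathcal D(t)=\rho_0+\sum_{p\ge1}\sum_{k=1}^{2^{p-1}}\rho_{p,k}t^{-\xi_{p,k}}$, where $\xi_{p,k}$ are the nonzero zeros and $\rho_0=1/f'(0)$, $\rho_{p,k}=1/f'(\xi_{p,k})$ for the meromorphic extension $f$ of $\int_0^1\frac{1-t^z}{1-t}d\mu(t)$). *)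

(* Defs.v *)
From HB Require Import structures.
From mathcomp Require Import all_boot all_order all_algebra.
From mathcomp Require Import all_classical all_reals all_analysis.
Import Order.TTheory GRing.Theory Num.Theory.
Local Open Scope ring_scope.

Definition asym_profile (R : realType) (t : R) : R :=
  (Num.sqrt (2 * pi * (1 - t)))^-1.

(* Main.v *)
(* Put [S_n = 1 + m_1 + ... + m_n]. Then [S_n ^ 2 - S_(n - 1) ^ 2 = 2 - m_n ^ 2], so
   [S_n ^ 2 ~ 2 n] by Cesaro and [m_n ~ 1 / sqrt (2 n)].
   Karamata's argument compares [mu], seen through [x |-> x ^ n], with Lebesgue
   measure seen through the Gaussian [v |-> exp (- v ^ 2)]: up to the factor
   [sqrt n], both have the same moments in the limit, since
   [\int exp (- j v ^ 2) dv = sqrt (pi / j)]. Integrating polynomials close to the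
   indicator of [y > exp (- a)] gives
   [mu ]exp (- a / n), 1] ~ 2 sqrt a / sqrt (2 pi n)]. As [D] is increasing, its
   value at [exp (- 1 / n)] lies between the averages of [D] over adjacent intervals
   [exp (- a / n), exp (- 1 / n)] and [exp (- 1 / n), exp (- b / n)],
   [b < 1 < a]; let [n] go to infinity and then [a] and [b] to [1]. *)
Require Import Defs.
From HB Require Import structures.
From mathcomp Require Import all_boot all_order all_algebra.
From mathcomp Require Import all_classical all_reals all_analysis.
From mathcomp Require Import measurable_realfun ring lra.
Import Order.TTheory GRing.Theory Num.Theory.
Import numFieldNormedType.Exports.
Local Open Scope classical_set_scope.
Local Open Scope ring_scope.

(** * Polynomial approximation of a step function *)

(** Induction from [(1 - z) (1 + (N + 1) z) <= 1 + N z]. It makes [(1 - z) ^ N] small once [N z] is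
    large; Bernoulli's inequality below makes [1 - (1 - z) ^ N] small when [N z] is. *)
Lemma bernoulli_sub_le1 (R : realFieldType) (z : R) (N : nat) :
  0 <= z <= 1 -> (1 - z) ^+ N * (1 + N%:R * z) <= 1.
Proof.
move=> /andP[z0 z1]; elim: N => [|N IH]; first by rewrite expr0 mul0r addr0 mulr1.
apply: le_trans IH.
rewrite exprSr -mulrA ler_wpM2l ?exprn_ge0 ?subr_ge0//.
have N0 : 0 <= N%:R :> R by [].
rewrite -(natr1 N); nra.
Qed.

Lemma bernoulli_sub_ge (R : realFieldType) (z : R) (N : nat) :
  0 <= z <= 1 -> 1 - (1 - z) ^+ N <= N%:R * z.
Proof.
move=> /andP[z0 z1]; elim: N => [|N IH]; first by rewrite expr0 mul0r subrr.
have h : 0 <= (1 - z) ^+ N <= 1.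
  by rewrite exprn_ge0 ?subr_ge0// exprn_ile1 ?subr_ge0// lerBlDl lerDr.
move: h => /andP[h0 h1]; rewrite exprSr -(natr1 N); nra.
Qed.

(* [q y = 1 - (1 - y ^ k) ^ N], where [c < d < c'] and [N] is of the order of
   [d ^ (- k)], so that [N y ^ k] is large for [y > c'] and small for [y <= c]. *)
Lemma switch_poly (R : realType) (c c' eps : R) :
  0 < c -> c < c' -> c' <= 1 -> 0 < eps ->
  exists2 q : {poly R}, q`_0 = 0 & forall y : R, 0 <= y <= 1 ->
    (c' < y)%R%:R - eps * y <= q.[y] <= (c < y)%R%:R + eps * y.
Proof.
move=> c0 cc' c'1 e0.
have [d cd dc'] : exists2 d : R, c < d & d < c' by exists ((c + c') / 2); lra.
have d0 : 0 < d by exact: lt_trans cd.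
have c'0 : 0 < c' by exact: lt_trans dc'.
have geo (x : R) : 0 < x -> x < 1 -> forall e, 0 < e ->
    \forall k \near \oo, x ^+ k < e.
  move=> x0 x1 e ee.
  have /cvgrPdist_lt/(_ e ee) : (GRing.exp x : R^nat) @ \oo --> (0 : R).
    by apply: cvg_expr; rewrite gtr0_norm.
  by apply: filterS => k; rewrite sub0r normrN gtr0_norm ?exprn_gt0.
have r1 : d / c' < 1 by rewrite ltr_pdivrMr// mul1r.
have r2 : c / d < 1 by rewrite ltr_pdivrMr// mul1r.
(* The first smallness condition serves the range [y > c'], the second the range [y <= c]; its
   factor 2 absorbs the bound [N d ^ k <= 2]. *)
have [k [k0 k1 k2]] : exists k, [/\ (0 < k)%N, (d / c') ^+ k < eps * c' &
    (c / d) ^+ k < eps * c / 2].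
  near \oo => k; exists k; split.
  - by near: k; exact: nbhs_infty_gt.
  - by near: k; apply: geo; [exact: divr_gt0|by []|exact: mulr_gt0].
  - by near: k; apply: geo; [exact: divr_gt0|by []|rewrite divr_gt0// mulr_gt0].
have dk0 : 0 < d ^+ k by rewrite exprn_gt0.
have [N Nge Nle] : exists2 N : nat, 1 <= N%:R * d ^+ k & N%:R * d ^+ k <= 2.
  exists (Num.truncn (d ^- k)).+1.
    by rewrite -ler_pdivrMr// mul1r ltW// truncnS_gt.
  have dk1 : d ^+ k <= 1 by rewrite exprn_ile1 ?(ltW d0)// ltW// (lt_le_trans dc').
  have : (Num.truncn (d ^- k))%:R * d ^+ k <= 1.
    by rewrite -ler_pdivlMr// mul1r truncn_le invr_ge0 ltW.
  rewrite -natr1; lra.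
exists (1 - (1 - 'X^k) ^+ N).
  by rewrite -horner_coef0 !hornerE expr0n gtn_eqF//= subr0 expr1n subrr.
move=> y /andP[y0 y1].
have yk : 0 <= y ^+ k <= 1 by rewrite exprn_ge0// exprn_ile1.
have /andP[yk0 yk1] := yk.
rewrite !hornerE.
have P0 : 0 <= (1 - y ^+ k) ^+ N by rewrite exprn_ge0// subr_ge0.
have P1 : (1 - y ^+ k) ^+ N <= 1 by rewrite exprn_ile1 ?subr_ge0// lerBlDl lerDr.
have ey : 0 <= eps * y by rewrite mulr_ge0// ltW.
have [yc|cy] := leP y c.
  have -> : (c' < y)%R = false by apply/negbTE; rewrite -leNgt (le_trans yc)// ltW.
  rewrite /= mulr0n add0r; apply/andP; split; first lra.
  apply: le_trans (@bernoulli_sub_ge _ _ N yk) _.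
  (* Since [y ^ (k - 1) <= c ^ (k - 1)], the bound [N y ^ k] becomes linear in [y], which the error
     term [eps * y] requires. *)
  have ykc : y ^+ k * c <= y * c ^+ k.
    rewrite -(prednK k0) !exprS [c * _]mulrC mulrA ler_wpM2r ?(ltW c0)//.
    by rewrite ler_wpM2l// lerXn2r// ?nnegrE ?(ltW c0).
  have Nck : N%:R * c ^+ k <= eps * c.
    have -> : N%:R * c ^+ k = (N%:R * d ^+ k) * (c / d) ^+ k.
      by rewrite expr_div_n; field; rewrite gt_eqF.
    have cdk : 0 <= (c / d) ^+ k by rewrite exprn_ge0// divr_ge0// ltW.
    nra.
  rewrite add0r -(ler_pM2r c0).
  have := ler_wpM2l (ler0n R N) ykc; have := ler_wpM2l y0 Nck.
  move: (c ^+ k) (y ^+ k) (N%:R : R) => u v w; lra.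
rewrite /= ?mulr1n.
(* For [y > c] the upper bound is trivial, as [q <= 1]; for [c < y <= c'] so is the lower one, as
   [q >= 0]. *)
apply/andP; split; last lra.
have [y'|y'] := ltP c' y; last by rewrite /= mulr0n; lra.
rewrite /= ?mulr1n.
have := @bernoulli_sub_le1 _ _ N yk.
set P := (1 - y ^+ k) ^+ N in P0 P1 *.
set e := (d / c') ^+ k in k1.
(* With [N y ^ k >= 1 / e], the inequality [P (1 + N y ^ k) <= 1] yields
   [P <= e < eps c' <= eps y]. *)
have y'k : 1 <= e * (N%:R * y ^+ k).
  have h : c' ^+ k <= y ^+ k by rewrite lerXn2r ?nnegrE ?(ltW c'0)// ltW.
  have e0' : 0 <= e by rewrite exprn_ge0// divr_ge0// ltW.
  apply: le_trans (ler_wpM2l e0' (ler_wpM2l (ler0n _ N) h)).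
  suff -> : e * (N%:R * c' ^+ k) = N%:R * d ^+ k by [].
  by rewrite /e expr_div_n; field; rewrite gt_eqF// exprn_gt0.
move=> PN.
have : P <= e.
  have : 0 <= e by rewrite exprn_ge0// divr_ge0// ltW.
  nra.
move: k1; rewrite -/e => k1.
have : eps * c' <= eps * y by rewrite ler_wpM2l// ltW.
lra.
Unshelve. all: by end_near.
Qed.

(** * Asymptotics of the moments *)

Lemma cvg_sqrt_mul_moment (R : realType) (m : nat -> R)
  (hmpos : forall n, 0 < m n)
  (hmrec : forall n, (1 <= n)%N -> (1 + \sum_(1 <= k < n.+1) m k) * m n = 1) :
  (fun n => Num.sqrt n%:R * m n) @ \oo --> (Num.sqrt 2)^-1.
Proof.
pose T n := 1 + \sum_(1 <= k < n.+1) m k.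
have T0 : T 0%N = 1 by rewrite /T big_nil addr0.
have TS n : T n.+1 = T n + m n.+1 by rewrite /T big_nat_recr//= addrA.
have Tm n : T n.+1 * m n.+1 = 1 by exact: hmrec.
have T1 n : 1 <= T n.
  by elim: n => [|n IH]; rewrite ?T0// TS (le_trans IH)// lerDl ltW.
have T2 n : T n.+1 ^+ 2 = T n ^+ 2 + 2 - m n.+1 ^+ 2.
  have h : T n = T n.+1 - m n.+1 by rewrite TS addrK.
  have := Tm n; rewrite h; move: (T n.+1) (m n.+1) => u v uv.
  have -> : (u - v) ^+ 2 + 2 - v ^+ 2 = u ^+ 2 + 2 * (1 - u * v) by ring.
  by rewrite uv subrr mulr0 addr0.
have m1 n : m n.+1 <= 1.
  have := Tm n; have := T1 n.+1; have := hmpos n.+1; nra.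
(* This crude growth, obtained from [m <= 1], already forces [m n] to tend to 0, so that the
   increments of [T ^ 2] tend to exactly 2. *)
have Tge n : n.+1%:R <= T n ^+ 2.
  elim: n => [|n IH]; first by rewrite T0 expr1n.
  rewrite T2 -natr1; have := m1 n; have := hmpos n.+1; nra.
have mT n : (m n.+1) ^+ 2 = (T n.+1 ^+ 2)^-1.
  have u : T n.+1 != 0 by rewrite gt_eqF// (lt_le_trans _ (T1 _)).
  by rewrite -exprVn; congr (_ ^+ 2); apply: (mulfI u); rewrite Tm divff.
have m20 : (fun n => m n.+1 ^+ 2) @ \oo --> 0.
  apply: (@squeeze_cvgr _ _ _ _ (fun=> 0) harmonic).
  - near=> n; rewrite sqr_ge0/= mT lef_pV2 ?posrE ?exprn_gt0 ?(lt_le_trans _ (T1 _))//.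
    by apply: le_trans (Tge _); rewrite ler_nat.
  - exact: cvg_cst.
  - exact: cvg_harmonic.
have u2 : (fun n => T n.+1 ^+ 2 - T n ^+ 2) @ \oo --> (2 : R).
  have -> : (fun n => T n.+1 ^+ 2 - T n ^+ 2) = (fun n => 2 - m n.+1 ^+ 2).
    by apply/funext => n; rewrite T2; ring.
  rewrite -[X in _ --> X]subr0; apply: cvgB m20; exact: cvg_cst.
have := cesaro u2.
have -> : arithmetic_mean (fun n => T n.+1 ^+ 2 - T n ^+ 2) =
    (fun n => (T n.+1 ^+ 2 - 1) / n.+1%:R).
  apply/funext => n; rewrite /arithmetic_mean /series/= telescope_sumr// T0 expr1n.
  by rewrite mulrC.
move=> c2.
have c3 : (fun n => T n.+1 ^+ 2 / n.+1%:R) @ \oo --> (2 : R).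
  have -> : (fun n => T n.+1 ^+ 2 / n.+1%:R) =
     (fun n => (T n.+1 ^+ 2 - 1) / n.+1%:R) \+ harmonic.
    by apply/funext => n /=; rewrite -[X in _ + X]mul1r -mulrDl subrK.
  rewrite -[X in _ --> X]addr0; apply: cvgD c2 _; exact: cvg_harmonic.
(* The index 0 is dropped because the relation [T n * m n = 1] comes from the recurrence, which
   starts at 1. *)
rewrite -cvg_shiftS/=.
have -> : (fun n => Num.sqrt n.+1%:R * m n.+1) =
    (fun n => (Num.sqrt (T n.+1 ^+ 2 / n.+1%:R))^-1).
  apply/funext => n.
  rewrite sqrtrM ?sqr_ge0// sqrtrV// invfM invrK mulrC; congr (_ * _).
  rewrite sqrtr_sqr ger0_norm ?(le_trans _ (T1 _))//.
  have u : T n.+1 != 0 by rewrite gt_eqF// (lt_le_trans _ (T1 _)).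
  by apply: (mulfI u); rewrite Tm divff.
apply: cvgV; first by rewrite gt_eqF// sqrtr_gt0.
by apply: continuous_cvg c3; exact: sqrt_continuous.
Unshelve. all: by end_near.
Qed.

(** * Bounding measures of superlevel sets by moments *)

Section moments.
Context {d : measure_display} {T : measurableType d} {R : realType}.
Context (mu : {measure set T -> \bar R}) (D : set T) (Y : T -> R) (M : nat -> R).
Context (mD : measurable D) (mY : measurable_fun setT Y).
Context (Y01 : forall x, D x -> 0 <= Y x <= 1).
Context (momY : forall i, (0 < i)%N ->
  (\int[mu]_(x in D) (Y x ^+ i)%:E = (M i)%:E)%E).

(** Only positive powers are considered: [D] may have infinite measure, as the real line does for
    Lebesgue measure. This is why the polynomials below have no constant term. *)
Lemma integrable_moment i : (0 < i)%N ->
  mu.-integrable D (fun x => (Y x ^+ i)%:E).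
Proof.
move=> i0; apply/integrableP; split.
  apply/measurable_EFinP; apply: measurable_funX.
  exact: measurable_funS mY.
under eq_integral => x.
  rewrite inE => Dx; have /andP[Y0 _] := Y01 _ Dx.
  rewrite gee0_abs ?lee_fin ?exprn_ge0//.
over.
by rewrite momY// ltry.
Qed.

Let term_integrable (p : {poly R}) : p`_0 = 0 -> forall i : nat,
  mu.-integrable D (fun x => ((p`_i)%:E * (Y x ^+ i)%:E)%E).
Proof.
move=> p0 [|i]; last by apply: integrableZl => //; exact: integrable_moment.
rewrite p0; under eq_fun do rewrite mul0e.
exact: integrable0.
Qed.

Let polyE (p : {poly R}) n : (size p <= n)%N -> forall x,
  (p.[Y x])%:E = (\sum_(i < n) ((p`_i)%:E * (Y x ^+ i)%:E))%E.
Proof.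
move=> pn x; rewrite (horner_coef_wide _ pn) -sumEFin.
by apply: eq_bigr => i _; rewrite EFinM.
Qed.

Lemma integrable_poly_moment (p : {poly R}) : p`_0 = 0 ->
  mu.-integrable D (fun x => (p.[Y x])%:E).
Proof.
move=> p0; under eq_fun do rewrite (@polyE _ (size p))//.
by apply: integrable_sum => // i _; exact: term_integrable.
Qed.

Lemma integral_poly_moment (p : {poly R}) n : p`_0 = 0 -> (size p <= n)%N ->
  (\int[mu]_(x in D) (p.[Y x])%:E = (\sum_(i < n) p`_i * M i)%:E)%E.
Proof.
move=> p0 pn; under eq_integral do rewrite (@polyE _ n)//.
rewrite integral_sum//; last by move=> i; exact: term_integrable.
rewrite -sumEFin; apply: eq_bigr => -[[|i] ?] _ /=.
  by rewrite p0 mul0r; under eq_integral do rewrite mul0e; rewrite integral0.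
rewrite integralZl//; last exact: integrable_moment.
by rewrite momY.
Qed.

Lemma measurable_gt_set (c : R) : measurable [set x | c < Y x].
Proof.
have := mY measurableT _ (measurable_itv `]c, +oo[).
by rewrite setTI; congr measurable; apply/seteqP; split => x /=;
  rewrite in_itv/= andbT.
Qed.

Let indicE (x : T) c : \1_[set x | c < Y x] x = (c < Y x)%R%:R :> R.
Proof. by rewrite indicE; congr (_%:R); rewrite mem_setE. Qed.

Lemma measure_gt_le_moment (p : {poly R}) n (c : R) : p`_0 = 0 -> (size p <= n)%N ->
  (forall y : R, 0 <= y <= 1 -> (c < y)%R%:R <= p.[y]) ->
  (mu ([set x | c < Y x]%R `&` D) <= (\sum_(i < n) p`_i * M i)%:E)%E.
Proof.
move=> p0 pn cp; rewrite -integral_poly_moment// -integral_indic//; last first.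
  exact: measurable_gt_set.
apply: ge0_le_integral => //.
- apply/measurable_EFinP; apply: measurable_funTS; apply: measurable_indic.
  exact: measurable_gt_set.
- by have /integrableP[] := @integrable_poly_moment p p0.
- by move=> x Dx; rewrite lee_fin indicE cp// Y01.
Qed.

Lemma moment_le_measure_gt (p : {poly R}) n (c : R) : p`_0 = 0 -> (size p <= n)%N ->
  (forall y : R, 0 <= y <= 1 -> p.[y] <= (c < y)%R%:R) ->
  ((\sum_(i < n) p`_i * M i)%:E <= mu ([set x | c < Y x]%R `&` D))%E.
Proof.
move=> p0 pn cp.
(* If the measure is infinite the bound is trivial. Otherwise the indicator is integrable, which the
   comparison needs since [p] may take negative values. *)
have [->|fin] := eqVneq (mu ([set x | c < Y x]%R `&` D)) +oo%E; first exact: leey.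
rewrite -integral_poly_moment// -integral_indic//; last exact: measurable_gt_set.
apply: le_integral => //.
- exact: integrable_poly_moment.
- apply/integrableP; split.
    apply/measurable_EFinP; apply: measurable_funTS; apply: measurable_indic.
    exact: measurable_gt_set.
  under eq_integral do rewrite gee0_abs ?lee_fin//.
  by rewrite integral_indic ?ltey//; exact: measurable_gt_set.
- by move=> x; rewrite inE => Dx; rewrite lee_fin indicE cp// Y01.
Qed.

End moments.

(** * Gaussian moments and Karamata's argument *)

(** Up to the factor [sqrt (pi / j)], the integrand is the centred normal density of variance
    [1 / (2 j)], whose total mass is 1. *)
Lemma gauss_moment (R : realType) (j : nat) : (0 < j)%N ->
  (\int[@lebesgue_measure R]_v ((expR (- v ^+ 2)) ^+ j)%:E =
    (Num.sqrt pi / Num.sqrt j%:R)%:E)%E.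
Proof.
move=> j0.
have J : 0 < j%:R :> R by rewrite ltr0n.
pose s : R := (Num.sqrt (2 * j%:R))^-1.
have s0 : 0 < s by rewrite invr_gt0 sqrtr_gt0 mulr_gt0.
have s2 : s ^+ 2 = (2 * j%:R)^-1 by rewrite exprVn sqr_sqrtr// mulr_ge0// ltW.
have := integral_normal_pdf 0 s.
pose K : R := Num.sqrt pi / Num.sqrt j%:R.
have K0 : 0 < K by rewrite divr_gt0// sqrtr_gt0// pi_gt0.
have E (v : R) : normal_pdf 0 s v = K^-1 * (expR (- v ^+ 2)) ^+ j.
  rewrite /normal_pdf gt_eqF//= /normal_peak /normal_fun; congr (_ * _).
    congr (_^-1); rewrite s2 /K -sqrtrV// -sqrtrM ?pi_ge0//; congr (Num.sqrt _).
    by field; rewrite gt_eqF.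
  rewrite -expRM_natr subr0 s2; congr expR.
  by field; rewrite gt_eqF.
under eq_integral do rewrite E EFinM.
have mf : measurable_fun setT (fun v : R => (expR (- v ^+ 2) ^+ j)%:E).
  apply/measurable_EFinP; apply: measurable_funX.
  apply: measurableT_comp => //; apply: measurableT_comp => //.
rewrite ge0_integralZl//=; last by rewrite lee_fin invr_ge0 ltW.
move=> h; rewrite -/K -[RHS]mule1 -h muleA -EFinM divff ?gt_eqF// mul1e.
by [].
Qed.

Lemma lebesgue_gauss_gt (R : realType) (a : R) : 0 < a ->
  @lebesgue_measure R ([set v | expR (- a) < expR (- v ^+ 2)]%R `&` setT) =
  (2 * Num.sqrt a)%:E.
Proof.
move=> a0; rewrite setIT.
have -> : [set v : R | expR (- a) < expR (- v ^+ 2)] = `](- Num.sqrt a), (Num.sqrt a)[%classic.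
  have vE (v : R) : (v ^+ 2 < a) = (`|v| < Num.sqrt a).
    by rewrite -{1}(sqr_sqrtr (ltW a0)) -[v ^+ 2]real_normK ?num_real// ltr_sqr ?nnegrE.
  by apply/seteqP; split => v /=; rewrite ltr_expR ltrN2 in_itv/= -ltr_norml vE.
have sa : 0 < Num.sqrt a by rewrite sqrtr_gt0.
rewrite lebesgue_measure_itv/= lte_fin ifT; last lra.
by rewrite -EFinD opprK mulr_natl mulr2n.
Qed.

(** The limit is the Gaussian value [2 sqrt a] times [K / sqrt pi], the ratio of the rescaled
    moments of [mu] in the limit to the Gaussian ones. *)
Lemma karamata_tauberian (R : realType) (mu : {finite_measure set R -> \bar R})
    (m : nat -> R) (K a : R) :
  (forall n, (\int[mu]_(x in `[0%R, 1%R]) (x ^+ n)%:E = (m n)%:E)%E) ->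
  (fun n => Num.sqrt n%:R * m n) @ \oo --> K -> 0 < a ->
  (fun n => Num.sqrt n%:R *
     fine (mu ([set x | expR (- a) < x ^+ n]%R `&` `[0, 1]))) @ \oo -->
  K * (2 * Num.sqrt a / Num.sqrt pi).
Proof.
move=> hmom hK a0.
pose F n b := Num.sqrt n%:R *
  fine (mu ([set x | expR (- b) < x ^+ n]%R `&` `[0, 1])).
pose MG (j : nat) : R := Num.sqrt pi / Num.sqrt j%:R.
have spi : 0 < Num.sqrt pi :> R by rewrite sqrtr_gt0 pi_gt0.
have Kge : 0 <= K.
  apply: (cvgr_to_ge hK); near=> n.
  rewrite mulr_ge0 ?sqrtr_ge0// -lee_fin -hmom; apply: integral_ge0 => x /=.
  by rewrite in_itv/= => /andP[x0 _]; rewrite lee_fin exprn_ge0.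
(* The polynomial switches between the levels [exp (- c)] and [exp (- b)], so [mu] at one level is
   compared with the Gaussian at the other. *)
have sandwich (b c eps : R) : 0 < b -> b < c -> 0 < eps ->
   (\forall n \near \oo, F n b <= K / Num.sqrt pi * (2 * Num.sqrt c) + eps) /\
   (\forall n \near \oo, K / Num.sqrt pi * (2 * Num.sqrt b) - eps <= F n c).
  move=> b0 bc eps0.
  (* Chosen so that [2 K del < eps]; [K + 1] replaces [K] because [K] may vanish. *)
  pose del := eps / (3 * (K + 1)).
  have del0 : 0 < del by rewrite divr_gt0// mulr_gt0// ltr_wpDl.
  have [q q0 qP] : exists2 q : {poly R}, q`_0 = 0 & forall y : R, 0 <= y <= 1 ->
      (expR (- b) < y)%R%:R - del * y <= q.[y] <= (expR (- c) < y)%R%:R + del * y.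
    apply: switch_poly => //; first exact: expR_gt0.
      by rewrite ltr_expR ltrN2.
    by rewrite -expR0 ler_expR oppr_le0 ltW.
  (* At least 2, so that the sums over [i < N] contain the coefficient of ['X]. *)
  pose N := maxn (size q) 2.
  (* Adding or removing the error term [del y] turns [q] into a majorant of the indicator at level
     [exp (- b)] and a minorant of the one at level [exp (- c)]. *)
  pose pU := q + del *: 'X.
  pose pL := q - del *: 'X.
  have pU0 : pU`_0 = 0 by rewrite /pU coefD coefZ coefX mulr0 addr0.
  have pL0 : pL`_0 = 0 by rewrite /pL coefB coefZ coefX mulr0 subr0.
  have sX : (size (del *: 'X : {poly R}) <= N)%N.
    by rewrite (leq_trans (size_scale_leq _ _))// size_polyX leq_max leqnn orbT.
  have pUN : (size pU <= N)%N.
    by rewrite (leq_trans (size_polyD _ _))// geq_max leq_max leqnn sX.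
  have pLN : (size pL <= N)%N.
    by rewrite (leq_trans (size_polyD _ _))// size_polyN geq_max leq_max leqnn sX.
  have pUb y : 0 <= y <= 1 -> (expR (- b) < y)%R%:R <= pU.[y].
    by move=> /qP /andP[h _]; rewrite /pU !hornerE -lerBlDr.
  have pLc y : 0 <= y <= 1 -> pL.[y] <= (expR (- c) < y)%R%:R.
    by move=> /qP /andP[_ h]; rewrite /pL !hornerE lerBlDr.
  pose L (p : {poly R}) (M : nat -> R) := \sum_(i < N) p`_i * M i.
  have LX M p s : L (p + s *: 'X) M = L p M + s * M 1%N.
    have N1 : (1 < N)%N by rewrite leq_max leqnn orbT.
    rewrite /L; under eq_bigr do rewrite coefD coefZ coefX mulrDl.
    rewrite big_split/=; congr (_ + _).
    rewrite (bigD1 (Ordinal N1))//= mulr1 big1 ?addr0// => i.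
    by rewrite -val_eqE/= => /negbTE ->; rewrite mulr0 mul0r.
  have mY : measurable_fun setT (fun v : R => expR (- v ^+ 2)).
    by apply: measurableT_comp => //; apply: measurableT_comp => //; exact: measurable_funX.
  have Y01 (v : R) : setT v -> 0 <= expR (- v ^+ 2) <= 1.
    by move=> _; rewrite expR_ge0 -expR0 ler_expR oppr_le0 sqr_ge0.
  have G1 : 2 * Num.sqrt b <= L pU MG.
    rewrite -lee_fin -lebesgue_gauss_gt//.
    by apply: measure_gt_le_moment => //; exact: gauss_moment.
  have G2 : L pL MG <= 2 * Num.sqrt c.
    rewrite -lee_fin -lebesgue_gauss_gt ?(lt_trans b0)//.
    by apply: moment_le_measure_gt => //; exact: gauss_moment.
  have Y01' n (x : R) : `[0, 1]%classic x -> 0 <= x ^+ n <= 1.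
    by rewrite /= in_itv/= => /andP[x0 x1]; rewrite exprn_ge0// exprn_ile1.
  have mom n i : (0 < i)%N ->
      (\int[mu]_(x in `[0%R, 1%R]) ((x ^+ n) ^+ i)%:E = (m (n * i)%N)%:E)%E.
    by move=> _; rewrite -hmom; apply: eq_integral => x _; rewrite exprM.
  have F1 n : F n b <= Num.sqrt n%:R * L pU (fun i => m (n * i)%N).
    rewrite ler_wpM2l ?sqrtr_ge0// -lee_fin fineK ?fin_num_measure//.
      apply: measure_gt_le_moment => //; [exact: Y01'|exact: mom].
    apply: measurableI => //; apply: measurable_gt_set; exact: measurable_funX.
  have F2 n : Num.sqrt n%:R * L pL (fun i => m (n * i)%N) <= F n c.
    rewrite ler_wpM2l ?sqrtr_ge0// -lee_fin fineK ?fin_num_measure//.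
      apply: moment_le_measure_gt => //; [exact: Y01'|exact: mom].
    apply: measurableI => //; apply: measurable_gt_set; exact: measurable_funX.
  have lim (p : {poly R}) : p`_0 = 0 ->
      (fun n => Num.sqrt n%:R * L p (fun i => m (n * i)%N)) @ \oo -->
      K / Num.sqrt pi * L p MG.
    move=> p0.
    have -> : (fun n => Num.sqrt n%:R * L p (fun i => m (n * i)%N)) =
        (fun n => \sum_(i < N) p`_i * (Num.sqrt n%:R * m (n * i)%N)).
      apply/funext => n; rewrite /L mulr_sumr; apply: eq_bigr => i _.
      by rewrite mulrCA.
    rewrite /L mulr_sumr.
    apply: cvg_big => //; first exact: add_continuous.
    move=> [[|i] iN] _ /=.
      rewrite p0 mul0r mulr0; under eq_fun do rewrite mul0r; exact: cvg_cst.
    rewrite mulrCA; apply: cvgMl_tmp.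
    have i0 : Num.sqrt i.+1%:R != 0 :> R by rewrite gt_eqF// sqrtr_gt0 ltr0n.
    have -> : K / Num.sqrt pi * MG i.+1 = K / Num.sqrt i.+1%:R.
      by rewrite /MG; field; rewrite i0 gt_eqF.
    (* The known asymptotics are applied along the subsequence of multiples of [i + 1]. *)
    have -> : (fun n => Num.sqrt n%:R * m (n * i.+1)%N) =
        (fun n => (Num.sqrt (n * i.+1)%:R * m (n * i.+1)%N) / Num.sqrt i.+1%:R).
      apply/funext => n; rewrite natrM sqrtrM//; field; exact: i0.
    apply: cvgMr_tmp.
    by apply: cvg_comp hK; exact: cvg_mulnr.
  have spi0 : Num.sqrt pi != 0 :> R by rewrite gt_eqF.
  have MG1 : MG 1%N = Num.sqrt pi by rewrite /MG sqrtr1 divr1.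
  (* The majorant and the minorant differ by [2 del 'X], hence only by a multiple of the first
     moment. *)
  have LUL : L pU MG = L pL MG + 2 * del * Num.sqrt pi.
    by rewrite /pU /pL -scaleNr !LX MG1; ring.
  have Kdel : 2 * K * del < eps.
    have -> : 2 * K * del = eps * (2 * K / (3 * (K + 1))).
      by rewrite /del; field; rewrite gt_eqF// ltr_wpDl.
    rewrite gtr_pMr// ltr_pdivrMr ?mulr_gt0 ?ltr_wpDl//; lra.
  have Ks : 0 <= K / Num.sqrt pi by rewrite divr_ge0// ltW.
  have e1 : K / Num.sqrt pi * (2 * del * Num.sqrt pi) = 2 * K * del.
    by field; exact: spi0.
  split.
    have h : K / Num.sqrt pi * L pU MG < K / Num.sqrt pi * (2 * Num.sqrt c) + eps.
      rewrite LUL mulrDr e1 ler_ltD// ler_wpM2l//.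
    move/cvgr_lt : (lim _ pU0) => /(_ _ h); apply: filterS => n hn.
    exact: le_trans (F1 n) (ltW hn).
  have h : K / Num.sqrt pi * (2 * Num.sqrt b) - eps < K / Num.sqrt pi * L pL MG.
    rewrite ltrBlDr (le_lt_trans (ler_wpM2l Ks G1))//.
    by rewrite LUL mulrDr e1 ltrD2l.
  move/cvgr_gt : (lim _ pL0) => /(_ _ h); apply: filterS => n hn.
  exact: le_trans (ltW hn) (F2 n).
apply/cvgrPdist_le => eps eps0.
have sa : 0 < Num.sqrt a by rewrite sqrtr_gt0.
(* The limit is linear in [sqrt a], so [sqrt a] is moved by [h] on each side: the first bound keeps
   [sqrt a - h] positive, the second makes the change of the limit at most [eps / 2]. *)
pose h := Num.min (Num.sqrt a / 2) (eps * Num.sqrt pi / (4 * (K + 1))).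
have K1 : 0 < K + 1 by rewrite ltr_wpDl.
have h0 : 0 < h by rewrite lt_min !divr_gt0// !mulr_gt0.
have ha : h <= Num.sqrt a / 2 by rewrite ge_min lexx.
have hK' : 2 * (K / Num.sqrt pi) * h <= eps / 2.
  have : h <= eps * Num.sqrt pi / (4 * (K + 1)) by rewrite ge_min lexx orbT.
  have Ks : 0 <= 2 * (K / Num.sqrt pi) by rewrite mulr_ge0// divr_ge0// ltW.
  move=> /(ler_wpM2l Ks) /le_trans; apply.
  have -> : 2 * (K / Num.sqrt pi) * (eps * Num.sqrt pi / (4 * (K + 1))) =
     eps / 2 * (K / (K + 1)).
    by field; rewrite !gt_eqF.
  rewrite ger_pMr ?divr_gt0// ler_pdivrMr//; lra.
have e2 : 0 < eps / 2 by rewrite divr_gt0.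
pose c := (Num.sqrt a + h) ^+ 2; pose b := (Num.sqrt a - h) ^+ 2.
have sc : Num.sqrt c = Num.sqrt a + h.
  by rewrite sqrtr_sqr gtr0_norm// addr_gt0.
have sb : Num.sqrt b = Num.sqrt a - h by rewrite sqrtr_sqr gtr0_norm//; lra.
have aE : a = Num.sqrt a ^+ 2 by rewrite sqr_sqrtr// ltW.
have ac : a < c by rewrite {1}aE ltr_sqr ?nnegrE ?addr_ge0 ?ltrDl// ltW.
have ba : b < a by rewrite [X in _ < X]aE ltr_sqr ?nnegrE//; lra.
have b0 : 0 < b by rewrite exprn_gt0//; lra.
have [U _] := sandwich a c _ a0 ac e2; have [_ V] := sandwich b a _ b0 ba e2.
near=> n.
have Un : F n a <= K / Num.sqrt pi * (2 * Num.sqrt c) + eps / 2 by near: n.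
have Vn : K / Num.sqrt pi * (2 * Num.sqrt b) - eps / 2 <= F n a by near: n.
move: Un Vn; rewrite sc sb.
have -> : K * (2 * Num.sqrt a / Num.sqrt pi) = K / Num.sqrt pi * (2 * Num.sqrt a).
  by field; rewrite gt_eqF.
rewrite -/(F n a) ler_norml; move: hK' (F n a) => + y Un Vn.
move: (K / Num.sqrt pi) Un Vn => k Un Vn hk.
apply/andP; split; lra.
Unshelve. all: by end_near.
Qed.

(** * From the measure of intervals to the monotone density *)

Lemma monotone_integral_bounds (R : realType) (D : R -> R) (t1 t2 : R) :
  t1 < t2 -> {in `[t1, t2] &, {homo D : x y / x <= y}} ->
  ((D t1 * (t2 - t1))%:E <= \int[lebesgue_measure]_(x in `]t1, t2]) (D x)%:E <=
   (D t2 * (t2 - t1))%:E)%E.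
Proof.
move=> t12 Dincr.
have l1 : t1 \in `[t1, t2] by rewrite in_itv/= lexx ltW.
have l2 : t2 \in `[t1, t2] by rewrite in_itv/= lexx ltW.
have sub (x : R) : `]t1, t2]%classic x -> x \in `[t1, t2].
  by rewrite /= !in_itv/= => /andP[/ltW -> ->].
have mI : @lebesgue_measure R `]t1, t2]%classic = (t2 - t1)%:E.
  by rewrite lebesgue_measure_itv/= lte_fin t12 -EFinD.
have mIy : (@lebesgue_measure R `]t1, t2]%classic < +oo)%E by rewrite mI ltry.
have mD : measurable_fun `]t1, t2]%classic D.
  (* Clamping the argument to [[t1, t2]] extends [D] to a monotone function on the whole line, hence
     a measurable one. *)
  refine (eq_measurable_fun (fun x : R => D (Num.max t1 (Num.min x t2))) _ _).
    move=> x; rewrite inE => /sub; rewrite in_itv/= => /andP[h1 h2].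
    by rewrite (min_idPl h2) (max_idPr h1).
  apply: nondecreasing_measurable => // x y xy; apply: Dincr.
  - by rewrite in_itv/= le_max lexx ge_max (ltW t12) ge_min lexx orbT.
  - by rewrite in_itv/= le_max lexx ge_max (ltW t12) ge_min lexx orbT.
  - by rewrite ge_max le_max lexx/= le_max le_min !ge_min xy lexx !orbT.
have icst (r : R) : (\int[lebesgue_measure]_(x in `]t1, t2]) (cst r x)%:E = (r * (t2 - t1))%:E)%E.
  have mt : measurable `]t1, t2]%classic by [].
  by rewrite EFinM -mI; exact: (integral_cst lebesgue_measure mt r%:E).
have iD : lebesgue_measure.-integrable `]t1, t2]%classic (EFin \o D).
  apply: measurable_bounded_integrable => //.
  exists (`|D t1| + `|D t2|); split; first exact: num_real.
  move=> M hM x /sub xI.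
  have /andP[h1 h2] : t1 <= x <= t2 by move: xI; rewrite in_itv.
  have := Dincr _ _ l1 xI h1; have := Dincr _ _ xI l2 h2.
  move=> d1 d2; apply: le_trans (ltW hM); rewrite ler_norml.
  have := ler_norm (D t2); have := normr_ge0 (D t1); have := normr_ge0 (D t2).
  have : - D t1 <= `|D t1| by rewrite -normrN ler_norm.
  by move=> ? ? ? ?; apply/andP; split; lra.
have ic (r : R) : lebesgue_measure.-integrable `]t1, t2]%classic (EFin \o cst r).
  apply: measurable_bounded_integrable => //.
  exists `|r|; split; first exact: num_real.
  by move=> M hM x _; exact: ltW.
rewrite -!icst; apply/andP; split; (apply: le_integral; [by []|exact: ic || exact: iD..|]);
  move=> x /[!inE] /sub xI; have /andP[h1 h2] : t1 <= x <= t2 by move: (xI); rewrite in_itv.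
- by rewrite lee_fin; exact: Dincr.
- by rewrite lee_fin; exact: Dincr.
Qed.

(** Squeeze from [x / (1 + x) <= 1 - exp (- x) <= x] at [x = a / n], both sides coming from
    [1 + x <= exp x]. *)
Lemma cvg_mul_1BexpRN (R : realType) (a : R) : 0 <= a ->
  (fun n => n%:R * (1 - expR (- (a / n%:R)))) @ \oo --> a.
Proof.
move=> a0.
apply: (@squeeze_cvgr _ _ _ _ (fun n : nat => a / (1 + a / n%:R)) (fun=> a)).
- near=> n.
  have n0 : 0 < n%:R :> R by rewrite ltr0n; near: n; exact: nbhs_infty_gt.
  have an : 0 <= a / n%:R by rewrite divr_ge0// ltW.
  apply/andP; split; last first.
    rewrite mulrC -ler_pdivlMr// lerBlDr addrC -lerBlDr.
    exact: expR_ge1Dx.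
  have -> : a / (1 + a / n%:R) = n%:R * ((a / n%:R) / (1 + a / n%:R)).
    by rewrite mulrA; congr (_ / _); rewrite mulrC divfK// gt_eqF.
  rewrite ler_wpM2l ?(ltW n0)//; move: (a / n%:R) an => x x0.
  have : (1 + x) * expR (- x) <= 1.
    by rewrite expRN ler_pdivrMr ?expR_gt0// mul1r expR_ge1Dx.
  rewrite ler_pdivrMr ?ltr_pwDl//; lra.
- rewrite -[X in _ --> X]divr1 -[X in _ / X]addr0.
  apply: cvgMl_tmp; apply: cvgV; first by rewrite addr0 oner_neq0.
  apply: cvgD; first exact: cvg_cst.
  rewrite -(mulr0 a); apply: cvgMl_tmp.
  by rewrite -cvg_shiftS; exact: cvg_harmonic.
- exact: cvg_cst.
Unshelve. all: by end_near.
Qed.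

Lemma monotone_density_nat (R : realType) (mu : {finite_measure set R -> \bar R})
    (m : nat -> R) (K : R) (D : R -> R) :
  (forall n, (\int[mu]_(x in `[0%R, 1%R]) (x ^+ n)%:E = (m n)%:E)%E) ->
  (fun n => Num.sqrt n%:R * m n) @ \oo --> K ->
  {in `]0, 1[ &, {homo D : x y / x <= y}} ->
  (forall A : set R, measurable A -> A `<=` `]0, 1[ ->
     mu A = (\int[lebesgue_measure]_(x in A) (D x)%:E)%E) ->
  (fun n => D (expR (- n%:R^-1)) / Num.sqrt n%:R) @ \oo --> K / Num.sqrt pi.
Proof.
move=> hmom hK Dincr Ddens.
pose t n a : R := expR (- (a / n%:R)).
pose G n a := fine (mu `](t n a), 1]%classic).
have spi : 0 < Num.sqrt pi :> R by rewrite sqrtr_gt0 pi_gt0.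
have Kge : 0 <= K.
  apply: (cvgr_to_ge hK); near=> n.
  rewrite mulr_ge0 ?sqrtr_ge0// -lee_fin -hmom; apply: integral_ge0 => x /=.
  by rewrite in_itv/= => /andP[x0 _]; rewrite lee_fin exprn_ge0.
pose k := K / Num.sqrt pi.
have k0 : 0 <= k by rewrite divr_ge0// ltW.
have cvgG a : 0 < a -> (fun n => Num.sqrt n%:R * G n a) @ \oo --> k * (2 * Num.sqrt a).
  move=> a0; have := karamata_tauberian _ _ _ _ _ hmom hK a0.
  have -> : K * (2 * Num.sqrt a / Num.sqrt pi) = k * (2 * Num.sqrt a).
    by rewrite /k; field; rewrite gt_eqF.
  (* For [n > 0], taking [n]-th roots turns the superlevel set of [x ^ n] into the interval []t n a,
     1]]. *)
  apply: cvg_trans; apply: near_eq_cvg; near=> n.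
  have n0 : (0 < n)%N by near: n; exact: nbhs_infty_gt.
  have n0R : n%:R != 0 :> R by rewrite gt_eqF// ltr0n.
  congr (_ * fine (mu _)); apply/seteqP; split => x /=; rewrite !in_itv/=.
    move=> [+ /andP[x0 ->]]; rewrite andbT.
    have -> : expR (- a) = (t n a) ^+ n by rewrite /t -expRM_natr mulNr divfK.
    by rewrite ltr_pXn2r// nnegrE expR_ge0.
  move=> /andP[tx x1]; have x0 : 0 <= x by rewrite (le_trans _ (ltW tx))// expR_ge0.
  split; last by rewrite x0.
  have -> : expR (- a) = (t n a) ^+ n by rewrite /t -expRM_natr mulNr divfK.
  by rewrite ltr_pXn2r// nnegrE expR_ge0.
have cvgt a b : 0 < a -> 0 < b -> (fun n => n%:R * (t n b - t n a)) @ \oo --> a - b.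
  move=> a0 b0.
  have -> : (fun n => n%:R * (t n b - t n a)) =
     (fun n => n%:R * (1 - t n a) - n%:R * (1 - t n b)).
    by apply/funext => n; ring.
  by apply: cvgB; apply: cvg_mul_1BexpRN; exact: ltW.
have bounds n a b : (0 < n)%N -> 0 < b -> b < a ->
    D (t n a) * (t n b - t n a) <= G n a - G n b <= D (t n b) * (t n b - t n a).
  move=> n0 b0 ba.
  have n0R : 0 < n%:R :> R by rewrite ltr0n.
  have tab : t n a < t n b by rewrite ltr_expR ltrN2 ltr_pM2r// invr_gt0.
  have tb1 : t n b < 1 by rewrite -expR0 ltr_expR oppr_lt0 divr_gt0.
  have ta0 : 0 < t n a by exact: expR_gt0.
  have in01 x : t n a <= x <= t n b -> x \in `]0, 1[.
    by move=> /andP[h1 h2]; rewrite in_itv/= (lt_le_trans ta0 h1) (le_lt_trans h2 tb1).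
  have := @monotone_integral_bounds R D _ _ tab.
  have -> : (\int[lebesgue_measure]_(x in `](t n a), (t n b)]) (D x)%:E)%E =
     (G n a - G n b)%:E.
    rewrite -Ddens//; last first.
      move=> x /=; rewrite in_itv/= => /andP[/ltW h1 h2]; by apply: in01; rewrite h1.
    (* Both intervals contain the endpoint 1, so any mass of [mu] there cancels in the
       difference. *)
    have -> : `](t n a), (t n b)]%classic = `](t n a), 1]%classic `\` `](t n b), 1]%classic.
      apply/seteqP; split => x /=; rewrite !in_itv/=.
        move=> /andP[-> h]; split; first by rewrite (le_trans h)// ltW.
        by rewrite ltNge h.
      by move=> [/andP[-> ->]]; rewrite andbT => /negP; rewrite -leNgt.
    have fin a' : mu `](t n a'), 1]%classic \is a fin_num by rewrite fin_num_measure.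
    rewrite measureD//; last by rewrite ltey_eq fin.
    rewrite setIidr; last first.
      by move=> x /=; rewrite !in_itv/= => /andP[h ->]; rewrite (lt_trans tab).
    by rewrite EFinB !fineK.
  rewrite !lee_fin; apply => x y.
  by rewrite !in_itv/= => /in01 x01 /in01 y01; exact: Dincr.
have tE n : expR (- n%:R^-1) = t n 1 by rewrite /t div1r.
under eq_fun do rewrite tE.
apply/cvgrPdist_le => eps eps0.
(* The auxiliary levels are [(1 - h) ^ 2] and [(1 + h) ^ 2]: their square roots are explicit, and
   the limiting averages become [2 k / (2 - h)] and [2 k / (2 + h)], within [eps] of [k] since
   [k h <= eps]. *)
pose h := Num.min (1 / 2) (eps / (k + 1)).
have h0 : 0 < h by rewrite lt_min !divr_gt0// ltr_wpDl.
have h12 : h <= 1 / 2 by rewrite ge_min lexx.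
have hk : k * h <= eps.
  have : h <= eps / (k + 1) by rewrite ge_min lexx orbT.
  rewrite ler_pdivlMr ?ltr_wpDl//; nra.
have quot a b : 0 < a -> 0 < b -> a != b ->
    (fun n => (Num.sqrt n%:R * G n a - Num.sqrt n%:R * G n b) / (n%:R * (t n b - t n a)))
     @ \oo --> k * (2 * (Num.sqrt a - Num.sqrt b)) / (a - b).
  move=> a0 b0 ab.
  have -> : k * (2 * (Num.sqrt a - Num.sqrt b)) =
      k * (2 * Num.sqrt a) - k * (2 * Num.sqrt b) by ring.
  apply: cvgM; first by apply: cvgB; exact: cvgG.
  by apply: cvgV; [rewrite subr_eq0|exact: cvgt].
have sqe (x : R) : 0 < x -> Num.sqrt (x ^+ 2) = x by move=> x0; rewrite sqrtr_sqr gtr0_norm.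
have hm : 0 < 1 - h by lra.
have hp : 0 < 1 + h by lra.
have bm : (1 - h) ^+ 2 < 1 by nra.
have bp : 1 < (1 + h) ^+ 2 by nra.
(* Upper bound: the value at [t n 1] is at most the average over the adjacent interval on its
   right. *)
have U : \forall n \near \oo, D (t n 1) / Num.sqrt n%:R <= k + eps.
  have /cvgr_lt : (fun n => (Num.sqrt n%:R * G n 1 - Num.sqrt n%:R * G n ((1 - h) ^+ 2)) /
      (n%:R * (t n ((1 - h) ^+ 2) - t n 1))) @ \oo --> k * (2 / (2 - h)).
    have -> : k * (2 / (2 - h)) =
        k * (2 * (Num.sqrt 1 - Num.sqrt ((1 - h) ^+ 2))) / (1 - (1 - h) ^+ 2).
      by rewrite sqe// sqrtr1; field; apply/andP; split; rewrite gt_eqF//; nra.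
    by apply: quot => //; [rewrite exprn_gt0|rewrite gt_eqF].
  have lt : k * (2 / (2 - h)) < k + eps.
    have : k * (2 / (2 - h)) * (2 - h) = 2 * k by field; rewrite gt_eqF//; lra.
    move: (k * _) => w wE; nra.
  move=> /(_ _ lt); apply: filter_app; near=> n => /ltW qn.
  have n0 : (0 < n)%N by near: n; exact: nbhs_infty_gt.
  have n0R : 0 < n%:R :> R by rewrite ltr0n.
  apply: le_trans qn.
  have b0 : 0 < (1 - h) ^+ 2 by rewrite exprn_gt0.
  have /andP[+ _] := bounds n 1 _ n0 b0 bm.
  set b := (1 - h) ^+ 2 in b0 bm *.
  have tt : 0 < t n b - t n 1 by rewrite subr_gt0 ltr_expR ltrN2 ltr_pM2r// invr_gt0.
  rewrite ler_pdivlMr ?mulr_gt0// -mulrBr => hb.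
  have s0 : 0 < Num.sqrt n%:R :> R by rewrite sqrtr_gt0.
  have -> : D (t n 1) / Num.sqrt n%:R * (n%:R * (t n b - t n 1)) =
     Num.sqrt n%:R * (D (t n 1) * (t n b - t n 1)).
    by rewrite -{2}(sqr_sqrtr (ltW n0R)); field; rewrite gt_eqF.
  by rewrite ler_wpM2l// ltW.
(* Lower bound: the value at [t n 1] is at least the average over the adjacent interval on its
   left. *)
have V : \forall n \near \oo, k - eps <= D (t n 1) / Num.sqrt n%:R.
  have /cvgr_gt : (fun n => (Num.sqrt n%:R * G n ((1 + h) ^+ 2) - Num.sqrt n%:R * G n 1) /
      (n%:R * (t n 1 - t n ((1 + h) ^+ 2)))) @ \oo --> k * (2 / (2 + h)).
    have -> : k * (2 / (2 + h)) =
        k * (2 * (Num.sqrt ((1 + h) ^+ 2) - Num.sqrt 1)) / ((1 + h) ^+ 2 - 1).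
      by rewrite sqe// sqrtr1; field; apply/andP; split; rewrite gt_eqF//; nra.
    by apply: quot => //; [rewrite exprn_gt0|rewrite gt_eqF].
  have lt : k - eps < k * (2 / (2 + h)).
    have : k * (2 / (2 + h)) * (2 + h) = 2 * k by field; rewrite gt_eqF//; lra.
    move: (k * _) => w wE; nra.
  move=> /(_ _ lt); apply: filter_app; near=> n => /ltW qn.
  have n0 : (0 < n)%N by near: n; exact: nbhs_infty_gt.
  have n0R : 0 < n%:R :> R by rewrite ltr0n.
  apply: le_trans qn _.
  have /andP[_ +] := bounds n _ 1 n0 ltr01 bp.
  set b := (1 + h) ^+ 2 in bp *.
  have tt : 0 < t n 1 - t n b by rewrite subr_gt0 ltr_expR ltrN2 ltr_pM2r// invr_gt0.
  rewrite ler_pdivrMr ?mulr_gt0// -mulrBr => hb.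
  have s0 : 0 < Num.sqrt n%:R :> R by rewrite sqrtr_gt0.
  have -> : D (t n 1) / Num.sqrt n%:R * (n%:R * (t n 1 - t n b)) =
     Num.sqrt n%:R * (D (t n 1) * (t n 1 - t n b)).
    by rewrite -{2}(sqr_sqrtr (ltW n0R)); field; rewrite gt_eqF.
  by rewrite ler_wpM2l// ltW.
near=> n; rewrite -/k ler_norml.
have Un : D (t n 1) / Num.sqrt n%:R <= k + eps by near: n.
have Vn : k - eps <= D (t n 1) / Num.sqrt n%:R by near: n.
by apply/andP; split; lra.
Unshelve. all: by end_near.
Qed.

(** * From the sequence [exp (- 1 / n)] to the left limit at 1 *)

(** With [n] the integer part of [1 / (- ln t)], the point [t] lies between [exp (- 1 / n)] and
    [exp (- 1 / (n + 1))]. Monotonicity brackets [D t], and the two scales [sqrt n] and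
    [sqrt (n + 1)] are equivalent. *)
Lemma monotone_cvg_at_left1 (R : realType) (D : R -> R) (k : R) :
  {in `]0, 1[ &, {homo D : x y / x <= y}} -> 0 < k ->
  (fun n => D (expR (- n%:R^-1)) / Num.sqrt n%:R) @ \oo --> k ->
  D t * Num.sqrt (1 - t) @[t --> 1^'-] --> k.
Proof.
move=> Dincr k0; set u : nat -> R := fun n => _ => uk.
pose N (t : R) := Num.truncn (- ln t)^-1.
have Noo : N t @[t --> 1^'-] --> \oo.
  apply/cvgnyPge => A; near=> t.
  have tA : expR (- A.+1%:R^-1) < t.
    near: t; apply: nbhs_left_gt.
    by rewrite -[X in _ < X]expR0 ltr_expR oppr_lt0 invr_gt0 ltr0n.
  have t0 : 0 < t by apply: lt_trans tA; exact: expR_gt0.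
  have t1 : t < 1 by near: t; exact: nbhs_left_lt.
  have y0 : 0 < - ln t by rewrite oppr_gt0 ln_lt0// t0.
  rewrite /N truncn_ge_nat ?invr_ge0 ?(ltW y0)//.
  apply: (@le_trans _ _ A.+1%:R); first by rewrite ler_nat.
  rewrite -[X in X <= _]invrK lef_pV2 ?posrE ?invr_gt0 ?ltr0n//.
  by rewrite lerNl -ler_expR lnK ?posrE// ltW.
pose v n : R := Num.sqrt n%:R / Num.sqrt n.+1%:R.
have v1 : v @ \oo --> (1 : R).
  have -> : v = (fun n => Num.sqrt (1 - harmonic n)).
    apply/funext => n; rewrite /v -sqrtrV// -sqrtrM//; congr (Num.sqrt _).
    by rewrite /= -(natr1 n); field; rewrite natr1 pnatr_eq0.
  rewrite -[X in _ --> X]sqrtr1 -[X in Num.sqrt X]subr0.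
  apply: continuous_cvg; first exact: sqrt_continuous.
  by apply: cvgB; [exact: cvg_cst|exact: cvg_harmonic].
(* Positivity of [D] near 1, available because [k > 0], permits multiplying the bounds for [D] by
   those for [sqrt (1 - t)]. *)
have u0 : \forall n \near \oo, 0 < u n.
  by move/cvgr_gt : uk; exact.
have uS : (fun n => u n.+1) @ \oo --> k by rewrite (cvg_shiftS u).
have u0S : \forall n \near \oo, 0 < u n.+1 by move/cvgr_gt : uS; exact.
apply: (@squeeze_cvgr _ _ _ _ (fun t => u (N t) * v (N t) * Num.sqrt t)
   (fun t => u (N t).+1 / v (N t))); last 2 first.
- have -> : k = k * 1 * Num.sqrt 1 by rewrite sqrtr1 !mulr1.
  apply: cvgM; last by apply: cvg_at_left_filter; exact: sqrt_continuous.
  by apply: (@cvg_comp _ _ _ N (fun n => u n * v n) _ _ _ Noo); exact: cvgM.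
- rewrite -[X in _ --> X]divr1.
  apply: (@cvg_comp _ _ _ N (fun n => u n.+1 / v n) _ _ _ Noo).
  by apply: cvgM => //; apply: cvgV.
near=> t.
have t0 : 0 < t by near: t; apply: nbhs_left_gt; exact: ltr01.
have t1 : t < 1 by near: t; exact: nbhs_left_lt.
have un : 0 < u (N t) by near: t; exact: (Noo _ u0).
have uSn : 0 < u (N t).+1 by near: t; exact: (Noo _ u0S).
have n0 : (0 < N t)%N by near: t; exact: (Noo _ (nbhs_infty_gt 0)).
have y0 : 0 < - ln t by rewrite oppr_gt0 ln_lt0// t0.
have /andP[] : (N t)%:R <= (- ln t)^-1 < (N t).+1%:R by rewrite truncn_itv// invr_ge0 ltW.
move: (N t) un uSn n0 => n un uSn n0 nle nlt.
have n0R : 0 < n%:R :> R by rewrite ltr0n.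
have nS0R : 0 < n.+1%:R :> R by rewrite ltr0n.
have yn : - ln t <= n%:R^-1 by rewrite -[X in X <= _]invrK lef_pV2 ?posrE ?invr_gt0.
have ySn : n.+1%:R^-1 < - ln t by rewrite -[X in _ < X]invrK ltf_pV2 ?posrE ?invr_gt0.
have en : expR (- n%:R^-1) <= t by rewrite -[X in _ <= X]lnK ?posrE// ler_expR lerNl.
have eSn : t <= expR (- n.+1%:R^-1).
  by rewrite -[X in X <= _]lnK ?posrE// ler_expR lerNr ltW.
have in01 (p : nat) : (0 < p)%N -> expR (- p%:R^-1) \in `]0 : R, 1[.
  move=> p0; rewrite in_itv/= expR_gt0 -[X in _ < X]expR0 ltr_expR oppr_lt0.
  by rewrite invr_gt0 ltr0n.
have tin : t \in `]0, 1[ by rewrite in_itv/= t0.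
have d1 := Dincr _ _ (in01 _ n0) tin en.
have d2 := Dincr _ _ tin (in01 n.+1 isT) eSn.
have sn : 0 < Num.sqrt n%:R :> R by rewrite sqrtr_gt0.
have sSn : 0 < Num.sqrt n.+1%:R :> R by rewrite sqrtr_gt0.
(* From [1 - t <= - ln t <= 1 / n]. *)
have s1 : Num.sqrt (1 - t) <= (Num.sqrt n%:R)^-1.
  rewrite -sqrtrV ?ler_wsqrtr ?(ltW n0R)//; apply: le_trans yn.
  by have := expR_ge1Dx (ln t); rewrite lnK ?posrE//; lra.
(* From [1 - t >= t (- ln t) >= t / (n + 1)]; this is the source of the factor [sqrt t] in the lower
   squeeze. *)
have s2 : Num.sqrt t / Num.sqrt n.+1%:R <= Num.sqrt (1 - t).
  rewrite -sqrtrV ?(ltW nS0R)// -sqrtrM ?(ltW t0)//; apply: ler_wsqrtr.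
  apply: (@le_trans _ _ (t * - ln t)); first by rewrite ler_wpM2l// ltW.
  have : 1 + - ln t <= t^-1.
    by apply: le_trans (expR_ge1Dx _) _; rewrite expRN lnK ?posrE.
  move=> /(ler_wpM2l (ltW t0)); rewrite divff ?gt_eqF//; lra.
have DE p : (0 < p)%N -> D (expR (- p%:R^-1)) = u p * Num.sqrt p%:R.
  by move=> p0; rewrite /u divfK// gt_eqF// sqrtr_gt0 ltr0n.
have s0 := sqrtr_ge0 (1 - t).
apply/andP; split.
  apply: le_trans (ler_wpM2r s0 d1); rewrite DE//.
  have -> : u n * v n * Num.sqrt t = u n * Num.sqrt n%:R * (Num.sqrt t / Num.sqrt n.+1%:R).
    by rewrite /v; ring.
  by rewrite ler_wpM2l// mulr_ge0// ltW.
apply: le_trans (ler_wpM2r s0 d2) _; rewrite DE//.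
have -> : u n.+1 / v n = u n.+1 * Num.sqrt n.+1%:R * (Num.sqrt n%:R)^-1.
  by rewrite /v invfM invrK; ring.
by rewrite ler_wpM2l// mulr_ge0// ltW.
Unshelve. all: by end_near.
Qed.

(** * The equivalent of the density at 1 *)

Theorem theorem3p9 (R : realType) (m : nat -> R)
  (hm0 : m 0%N = 1) (hmpos : forall n, 0 < m n)
  (hmrec : forall n, (1 <= n)%N -> (1 + \sum_(1 <= k < n.+1) m k) * m n = 1)
  (mu : probability R R)
  (hsupp : mu (~` `[0, 1]%classic) = 0%E)
  (hmom : forall n, (\int[mu]_(x in `[0%R, 1%R]%classic) (x ^+ n)%:E = (m n)%:E)%E)
  (D : R -> R)
  (hDincr : {in `]0, 1[ &, {homo D : x y / x <= y}})
  (hDdens : forall A : set R, measurable A -> A `<=` `]0%R, 1%R[%classic ->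
     mu A = (\int[lebesgue_measure]_(x in A) (D x)%:E)%E) :
  D ~_(at_left 1) (@asym_profile R).
Proof.
have lim := monotone_density_nat _ _ _ _ _ hmom (cvg_sqrt_mul_moment _ _ hmpos hmrec)
  hDincr hDdens.
have s2 : 0 < Num.sqrt 2 :> R by rewrite sqrtr_gt0.
have spi : 0 < Num.sqrt pi :> R by rewrite sqrtr_gt0 pi_gt0.
(* Here [k = 1 / sqrt (2 pi)]. *)
set k := _ / _ in lim; have k0 : 0 < k by rewrite divr_gt0// invr_gt0.
move/cvgrPdist_le : (monotone_cvg_at_left1 _ _ _ hDincr k0 lim) => kD.
apply/eqaddoP => eps eps0.
(* Since the profile is [k / sqrt (1 - t)], a relative error [eps] on [D t] is an absolute error
   [eps * k] on [D t * sqrt (1 - t)]. *)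
have ek : 0 < eps * k by rewrite mulr_gt0.
have := kD _ ek; apply: filter_app; near=> t => h.
have t1 : t < 1 by near: t; exact: nbhs_left_lt.
have s0 : 0 < Num.sqrt (1 - t) by rewrite sqrtr_gt0 subr_gt0.
have pE : asym_profile R t = k / Num.sqrt (1 - t).
  by rewrite /asym_profile !sqrtrM ?mulr_ge0 ?pi_ge0// !invfM.
rewrite /= pE [X in _ <= _ * X]ger0_norm ?divr_ge0 ?(ltW k0) ?(ltW s0)// mulrA.
rewrite ler_pdivlMr// -[X in _ * X](gtr0_norm s0) -normrM mulrBl pE divfK ?gt_eqF//.
by rewrite distrC.
Unshelve. all: by end_near.
Qed.
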